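(* Let $\tau:\mathcal D\to\mathcal D$ be a rearrangement and $T$ the induced operator $Th_I=h_{\tau(I)}$. The following are equivalent: (i) $T:\mathrm{BMO}\to\mathrm{BMO}$ is bounded; (ii) there exists $M\ge1$ such that $[\![\tau(\mathcal L)]\!]\le M[\![\mathcal L]\!]$ for every $\mathcal L\subset\mathcal D$; (iii) $\tau$ satisfies the weak-Property $\mathcal P$.
   Context: $\mathcal D$ is the collection of dyadic subintervals of $[0,1]$. A rearrangement is an injective map $\tau:\mathcal D\to\mathcal D$; $\tau^{-1}$ is its inverse on $\tau(\mathcal D)$. $h_I$ is the $L^\infty$-normalized Haar function ($1$ on the left half of $I$, $-1$ on the right half, $0$ outside). For $x=\sum x_Ih_I$, $\|x\|=\sup_{J\in\mathcal D}\big(\frac1{|J|}\sum_{I\subseteq J}x_I^2|I|\big)^{1/2}$ and $\mathrm{BMO}=\{x:\|x\|<\infty\}$ (dyadic BMO). For $\mathcal L\subset\mathcal D$: $[\![\mathcal L]\!]=\sup_{J\in\mathcal D}\frac1{|J|}\sum_{I\in\mathcal L,I\subseteq J}|I|$; $\mathcal L$ satisfies the $M$ Carleson condition if $[\![\mathcal L]\!]\le M$; $\mathcal L^*=\bigcup_{I\in\mathcal L}I$; $\mathcal L\cap J=\{I\in\mathcal L:I\subseteq J\}$; $\max\mathcal L$ is the set of elements of $\mathcal L$ maximal with respect to inclusion. Weak-Property $\mathcal P$: $\tau$ satisfies the weak-Property $\mathcal P$ if there is $M>0$ such that for every $\mathcal B\subset\mathcal D$ and every $J\in\mathcal D$ the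 collection $\tau(\mathcal B)\cap J$ can be written as a disjoint union $\bigcup_i\tau(\mathcal L_i)\cup\bigcup_i\mathcal E_i$ ($i\in\mathbb N$) such that (a) $\bigcup_i\mathcal E_i$ satisfies the $M$ Carleson condition; (b) $\frac{|\tau(I)|}{|I|}\le M\frac{|\tau(\mathcal L_i)^*|+|\mathcal E_i^*|}{|\mathcal L_i^*|}$ whenever $I\in\mathcal L_i$; (c) $\sum_i|\tau(\mathcal L_i)^*|\le M|J|\sup_i[\![\tau^{-1}(\max\tau(\mathcal L_i))]\!]$. *)

(* Defs.v *)
From HB Require Import structures.
From mathcomp Require Import all_boot all_order all_algebra.
From mathcomp Require Import all_classical all_reals all_analysis.
Set Implicit Arguments. Unset Strict Implicit. Unset Printing Implicit Defensive.
Import Order.TTheory GRing.Theory Num.Theory.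
Local Open Scope classical_set_scope.
Local Open Scope ring_scope.

(* Dyadic subintervals of [0,1]: (n,k) with k < 2^n stands for
   [k/2^n, (k+1)/2^n). *)
Definition dyad := {p : nat * nat | (p.2 < 2 ^ p.1)%N}.

Section Dyadic.
Variable R : realType.

Definition dlev (I : dyad) : nat := (val I).1.
Definition dpos (I : dyad) : nat := (val I).2.

Definition dint (I : dyad) : set R :=
  `[ (dpos I)%:R / 2 ^+ dlev I, (dpos I).+1%:R / 2 ^+ dlev I [.

Definition dlen (I : dyad) : R := (2 ^+ dlev I)^-1.

Definition dsub (I J : dyad) : Prop := dint I `<=` dint J.

Definition rearrangement (tau : dyad -> dyad) : Prop := injective tau.

(* squared dyadic BMO norm of x = sum_I x_I h_I:
   ||x||^2 = sup_J (1/|J|) sum_{I ⊆ J} x_I^2 |I|   (in \bar R) *)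
Definition bmo_sq (x : dyad -> R) : \bar R :=
  ereal_sup (range (fun J : dyad =>
    ((dlen J)^-1)%:E * \esum_(I in [set I | dsub I J]) (x I ^+ 2 * dlen I)%:E)%E).

(* coefficients of T x, where T h_I = h_{tau I}:
   (T x)_K = x_I if K = tau I, and 0 if K is not in the range of tau *)
Definition Top (tau : dyad -> dyad) (x : dyad -> R) (K : dyad) : R :=
  match pselect (exists I, tau I = K) with
  | left H => x (proj1_sig (cid H))
  | right _ => 0
  end.

Definition T_bounded_BMO (tau : dyad -> dyad) : Prop :=
  exists C : R, forall x : dyad -> R, (bmo_sq x < +oo)%E ->
    (bmo_sq (Top tau x) <= (C ^+ 2)%:E * bmo_sq x)%E.

Definition carl (L : set dyad) : \bar R :=
  ereal_sup (range (fun J : dyad =>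
    ((dlen J)^-1)%:E * \esum_(I in [set I | L I /\ dsub I J]) (dlen I)%:E)%E).

Definition dunion (L : set dyad) : set R := \bigcup_(I in L) dint I.
Definition lmeas (L : set dyad) : \bar R := (@lebesgue_measure R) (dunion L).

Definition dcapJ (L : set dyad) (J : dyad) : set dyad := [set I | L I /\ dsub I J].

Definition dmax (L : set dyad) : set dyad :=
  [set I | L I /\ forall K, L K -> dsub I K -> K = I].

Definition weak_property_P (tau : dyad -> dyad) : Prop :=
  exists M : R, 0 < M /\
  forall (B : set dyad) (J : dyad),
  exists (L E : nat -> set dyad),
    dcapJ (tau @` B) J = \bigcup_(i in [set: nat]) (tau @` L i) `|`
                         \bigcup_(i in [set: nat]) E i /\
    (forall i j, i <> j -> tau @` L i `&` tau @` L j = set0) /\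
    (forall i j, i <> j -> E i `&` E j = set0) /\
    (forall i j, tau @` L i `&` E j = set0) /\
    (carl (\bigcup_(i in [set: nat]) E i) <= M%:E)%E /\
    (forall i I, L i I ->
      dlen (tau I) / dlen I <=
      M * (fine (lmeas (tau @` L i)) + fine (lmeas (E i))) / fine (lmeas (L i))) /\
    (\sum_(0 <= i <oo) lmeas (tau @` L i) <=
      (M * dlen J)%:E *
      ereal_sup (range (fun i => carl (tau @^-1` (dmax (tau @` L i))))))%E.

End Dyadic.

(* Main.v *)
(* T is bounded as soon as tau maps 2-Carleson collections to C-Carleson ones:
   the weights x_I^2 / ||x||^2 are, up to an error 1/N, averages of N indicator
   functions of 2-Carleson collections. Testing T on indicators gives back (ii),
   and the decomposition in the weak-Property P, applied to a 2-Carleson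
   collection, gives the bound for 2-Carleson collections.

   For (ii) => (iii), let r(I) = |tau I| / |I|. Inside each interval K of a stopping
   tree choose a threshold theta such that {I < K : r(I) >= theta} covers at most
   half of K while {I < K : r(I) >= theta / 2} covers at least half of it (unless
   there is no I with r(I) < theta). The maximal intervals of the former collection
   are the successors of K. The tree is 2-Carleson, its image provides the sets E_i,
   and the L_i are the intervals between K and its successors. The maximal intervals
   with r >= theta / 2 lie in the L_i of K or among its successors, and by (ii) their
   images cover a set of measure at least a constant times theta |K|: this is (b).
   As the tree is Carleson, merging the collections tau^{-1}(max tau(L_i)) costs
   only a factor 3, which gives (c). *)
Require Import Defs.
From HB Require Import structures.
From mathcomp Require Import all_boot all_order all_algebra.
From mathcomp Require Import all_classical all_reals all_analysis.
From mathcomp Require Import zify ring lra.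
Import Order.TTheory GRing.Theory Num.Theory.
Local Open Scope classical_set_scope.
Local Open Scope ring_scope.
Set Implicit Arguments.
Unset Strict Implicit.
Unset Printing Implicit Defensive.

(** * Dyadic intervals *)

Notation dyad_pred := (fun p : nat * nat => is_true (p.2 < 2 ^ p.1)%N).

Lemma danc_subproof (I : dyad) (m : nat) :
  ((m, dpos I %/ 2 ^ (dlev I - m)).2 < 2 ^ (m, dpos I %/ 2 ^ (dlev I - m)).1)%N.
Proof.
rewrite /= ltn_divLR ?expn_gt0// -expnD; apply: leq_trans (valP I) _.
by rewrite leq_exp2l// -leq_subLR.
Qed.

(* The ancestor of [I] of level [m]; meaningful only for [m <= dlev I]. *)
Definition danc (I : dyad) (m : nat) : dyad := exist dyad_pred _ (danc_subproof I m).

(** Decidable, purely arithmetic form of inclusion; [dsubP] identifies it with [dsub]. *)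
Definition dle (I J : dyad) : bool := (dlev J <= dlev I)%N && (danc I (dlev J) == J).

Lemma dyad_eq (I J : dyad) : dlev I = dlev J -> dpos I = dpos J -> I = J.
Proof.
move=> h1 h2; apply: val_inj; rewrite [LHS]surjective_pairing [RHS]surjective_pairing.
by congr pair.
Qed.

Lemma dlev_danc (I : dyad) (m : nat) : dlev (danc I m) = m.
Proof. by []. Qed.

Lemma dpos_danc (I : dyad) (m : nat) : dpos (danc I m) = (dpos I %/ 2 ^ (dlev I - m))%N.
Proof. by []. Qed.

Lemma danc_danc (I : dyad) (m l : nat) : (m <= l <= dlev I)%N ->
  danc (danc I l) m = danc I m.
Proof.
move=> /andP[ml lI]; apply: dyad_eq => //.
rewrite !dpos_danc dlev_danc -divnMA -expnD; congr (_ %/ 2 ^ _)%N; lia.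
Qed.

Lemma danc_id (I : dyad) : danc I (dlev I) = I.
Proof. by apply: dyad_eq => //; rewrite dpos_danc subnn expn0 divn1. Qed.

Lemma dle_refl (I : dyad) : dle I I.
Proof. by rewrite /dle leqnn danc_id eqxx. Qed.

Lemma dle_lev (I J : dyad) : dle I J -> (dlev J <= dlev I)%N.
Proof. by case/andP. Qed.

Lemma dle_trans (J I K : dyad) : dle I J -> dle J K -> dle I K.
Proof.
move=> /andP[h1 /eqP h2] /andP[h3 /eqP h4].
rewrite /dle (leq_trans h3 h1)/=; apply/eqP.
by rewrite -(@danc_danc I _ (dlev J)) ?h3 ?h1 // h2.
Qed.

Lemma dle_lev_eq (I J : dyad) : dle I J -> dlev I = dlev J -> I = J.
Proof. by move=> /andP[_ /eqP <-] e; rewrite -{1}(danc_id I) e. Qed.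

Lemma dle_anti (I J : dyad) : dle I J -> dle J I -> I = J.
Proof.
move=> h1 h2; apply: dle_lev_eq => //.
by apply/eqP; rewrite eqn_leq (dle_lev h1) (dle_lev h2).
Qed.

Lemma dle_danc (I : dyad) (m : nat) : (m <= dlev I)%N -> dle I (danc I m).
Proof. by move=> h; rewrite /dle h /= eqxx. Qed.

Lemma dle_nested_lev (I J K : dyad) : dle I J -> dle I K -> (dlev K <= dlev J)%N ->
  dle J K.
Proof.
move=> /andP[h1 /eqP h2] /andP[h3 /eqP h4] h5; rewrite /dle h5/=; apply/eqP.
by rewrite -h2 danc_danc ?h5.
Qed.

Lemma dle_nested (I J K : dyad) : dle I J -> dle I K -> dle J K \/ dle K J.
Proof.
move=> h1 h2; case: (leqP (dlev K) (dlev J)) => h; [left|right].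
  exact: (dle_nested_lev h1 h2 h).
by apply: (dle_nested_lev h2 h1); exact: ltnW.
Qed.

Definition dlt (I J : dyad) : bool := dle I J && (I != J).

Lemma dltW (I J : dyad) : dlt I J -> dle I J.
Proof. by case/andP. Qed.

Lemma dlt_lev (I J : dyad) : dlt I J -> (dlev J < dlev I)%N.
Proof.
case/andP => h1 h2; rewrite ltn_neqAle dle_lev// andbT.
by apply: contra h2 => /eqP e; rewrite (dle_lev_eq h1)// -e.
Qed.

Lemma dltNle (I J : dyad) : dlt I J -> dle J I -> False.
Proof. by move=> h1 h2; have := dlt_lev h1; have := dle_lev h2; lia. Qed.

Lemma dle_lt_trans (J I K : dyad) : dle I J -> dlt J K -> dlt I K.
Proof.
move=> h1 h2; rewrite /dlt (dle_trans h1 (dltW h2)) /=.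
by apply/eqP => e; move: h1; rewrite e; exact: dltNle.
Qed.

Lemma dlt_le_trans (J I K : dyad) : dlt I J -> dle J K -> dlt I K.
Proof.
move=> h1 h2; rewrite /dlt (dle_trans (dltW h1) h2) /=.
by apply/eqP => e; move: h2; rewrite -e; exact: dltNle.
Qed.

Lemma dle_eqVlt (I J : dyad) : dle I J -> I = J \/ dlt I J.
Proof.
by move=> h; case: (eqVneq I J) => e; [left|right; rewrite /dlt h e].
Qed.

Lemma dlt_nested (I J K : dyad) : dle I J -> dle I K -> [\/ J = K, dlt J K | dlt K J].
Proof.
move=> h1 h2; case: (dle_nested h1 h2) => /dle_eqVlt[]; first by constructor 1.
- by constructor 2.
- by move=> ->; constructor 1.
- by constructor 3.
Qed.

Definition droot : dyad := exist dyad_pred (0, 0)%N isT.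

Lemma dle_root (I : dyad) : dle I droot.
Proof.
rewrite /dle /=; apply/eqP/dyad_eq => //.
by rewrite dpos_danc subn0 divn_small// (valP I).
Qed.

Lemma dchild_subproof (b : bool) (J : dyad) :
  (((dlev J).+1, (dpos J).*2 + b)%N.2 < 2 ^ ((dlev J).+1, (dpos J).*2 + b)%N.1)%N.
Proof.
have := valP J; rewrite /= /dlev /dpos expnS mul2n -!muln2.
by case: b => /=; lia.
Qed.

Definition dchild (b : bool) (J : dyad) : dyad := exist dyad_pred _ (dchild_subproof b J).

Lemma dlev_child (b : bool) (J : dyad) : dlev (dchild b J) = (dlev J).+1.
Proof. by []. Qed.

Lemma dpos_child (b : bool) (J : dyad) : dpos (dchild b J) = ((dpos J).*2 + b)%N.
Proof. by []. Qed.

Lemma danc_child (b : bool) (J : dyad) (m : nat) : (m <= dlev J)%N ->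
  danc (dchild b J) m = danc J m.
Proof.
move=> h; apply: dyad_eq => //; rewrite !dpos_danc dlev_child dpos_child.
rewrite subSn// expnS divnMA; congr (_ %/ _)%N.
by case: b; rewrite -muln2 ?addn0; lia.
Qed.

Lemma dle_child (b : bool) (J : dyad) : dle (dchild b J) J.
Proof. by rewrite /dle leqnSn danc_child// danc_id eqxx. Qed.

Lemma dlt_childP (I J : dyad) : dlt I J -> exists b, dle I (dchild b J).
Proof.
(* The ancestor of [I] one level below [J] is a child of [J], and the parity of its position tells
   which one. *)
move=> h; have hl := dlt_lev h; exists (odd (dpos (danc I (dlev J).+1))).
rewrite /dle dlev_child hl /=; apply/eqP/dyad_eq => //.
set P := danc I (dlev J).+1; have hP : dlev P = (dlev J).+1 by [].
have hJ : dpos J = dpos (danc P (dlev J)).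
  by move: (dltW h) => /andP[_ /eqP {1}<-]; rewrite danc_danc// leqnSn hl.
move: P hP hJ => P hP hJ.
by rewrite dpos_child hJ dpos_danc hP subSn// subnn expn1 divn2 addnC odd_double_half.
Qed.

Lemma dchild_disj (I J : dyad) : dle I (dchild false J) -> dle I (dchild true J) -> False.
Proof.
move=> /andP[_ /eqP h1] /andP[_ /eqP h2]; move: h2; rewrite h1.
by move=> /(congr1 dpos); rewrite !dpos_child addn0 addn1; lia.
Qed.

(* The dyadic subintervals of [J] of relative depth less than [k]. *)
Fixpoint ddesc (k : nat) (J : dyad) : seq dyad :=
  if k is k'.+1 then J :: ddesc k' (dchild false J) ++ ddesc k' (dchild true J) else [::].

Lemma mem_ddesc (k : nat) (I J : dyad) :
  (I \in ddesc k J) = dle I J && (dlev I < dlev J + k)%N.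
Proof.
elim: k J => [|k IH] J /=.
  rewrite in_nil addn0; apply/esym/negbTE/negP => /andP[/dle_lev]; lia.
rewrite in_cons mem_cat !IH !dlev_child !addSn addnS.
case: (eqVneq I J) => [->|e] /=; first by rewrite dle_refl ltnS leq_addr.
apply/idP/idP.
  by case/orP => /andP[h1 h2]; rewrite (dle_trans h1 (dle_child _ _)).
move=> /andP[h1 h2].
have [|b hb] := @dlt_childP I J; first by rewrite /dlt h1 e.
by case: b hb => -> /=; rewrite h2 ?orbT.
Qed.

Lemma uniq_ddesc (k : nat) (J : dyad) : uniq (ddesc k J).
Proof.
elim: k J => [//|k IH] J /=.
rewrite cat_uniq !IH mem_cat !mem_ddesc !andbT negb_or.
have hN b : dle J (dchild b J) = false.
  by apply/negP => /dle_lev; rewrite dlev_child; lia.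
rewrite !hN /=; apply/hasPn => I; rewrite !mem_ddesc => /andP[h _].
by apply/negP => /andP[h' _]; exact: dchild_disj h' h.
Qed.

(** * Carleson constants and measure *)

Section DyadicReal.
Variable R : realType.
Implicit Types (I J K Q : dyad) (x : R).

Lemma dlen_gt0 I : 0 < dlen R I.
Proof. by rewrite invr_gt0 exprn_gt0. Qed.

Lemma dlen_ge0 I : 0 <= dlen R I.
Proof. exact: ltW (dlen_gt0 I). Qed.

Lemma dlen_child b J : dlen R (dchild b J) = dlen R J / 2.
Proof. by rewrite /dlen dlev_child exprSr invfM mulrC. Qed.

Lemma dintP I x : @dint R I x <-> (dpos I)%:R <= x * 2 ^+ dlev I < (dpos I).+1%:R.
Proof.
rewrite /dint /= in_itv /= ler_pdivrMr ?exprn_gt0//.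
by rewrite ltr_pdivlMr ?exprn_gt0.
Qed.

(** On the grid of [I] the common point places [dpos I] in the block of [2 ^ (dlev I - dlev J)]
    consecutive integers that belongs to [J], so division returns [dpos J]. *)
Lemma dint_nested I J x : @dint R I x -> @dint R J x -> (dlev J <= dlev I)%N -> dle I J.
Proof.
move=> /dintP/andP[h1 h2] /dintP/andP[h3 h4] hl; rewrite /dle hl /=.
apply/eqP/dyad_eq => //; rewrite dpos_danc.
have e : 2 ^+ dlev I = 2 ^+ dlev J * (2 ^ (dlev I - dlev J))%N%:R :> R.
  by rewrite natrX -exprD subnKC.
set k := (2 ^ _)%N in e *; have k0 : (0 < k)%N by rewrite expn_gt0.
have k0' : 0 < k%:R :> R by rewrite ltr0n.
move: h1 h2; rewrite e mulrA => h1 h2.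
have : (dpos J * k < (dpos I).+1)%N.
  rewrite -(ltr_nat R) natrM; apply: le_lt_trans h2.
  by rewrite ler_pM2r.
have : (dpos I < (dpos J).+1 * k)%N.
  rewrite -(ltr_nat R) natrM; apply: le_lt_trans h1 _.
  by rewrite ltr_pM2r.
move=> h5 h6; apply/eqP; rewrite eqn_leq -ltnS ltn_divLR// h5 /=.
by rewrite leq_divRL.
Qed.

Lemma dle_dsub I J : dle I J -> dsub R I J.
Proof.
move=> /andP[hl /eqP hJ] x /dintP/andP[h1 h2]; apply/dintP.
have e : 2 ^+ dlev I = 2 ^+ dlev J * (2 ^ (dlev I - dlev J))%N%:R :> R.
  by rewrite natrX -exprD subnKC.
move: (dpos_danc I (dlev J)); rewrite hJ => ->.
set k := (2 ^ _)%N in e *; have k0 : (0 < k)%N by rewrite expn_gt0.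
have k0' : 0 < k%:R :> R by rewrite ltr0n.
move: h1 h2; rewrite e mulrA => h1 h2; apply/andP; split.
  rewrite -(ler_pM2r k0'); apply: le_trans h1; rewrite -natrM ler_nat.
  exact: leq_divM.
rewrite -(ltr_pM2r k0'); apply: lt_le_trans h2 _; rewrite -natrM ler_nat.
by rewrite ltn_ceil.
Qed.

Lemma dint_left I : @dint R I ((dpos I)%:R / 2 ^+ dlev I).
Proof. by apply/dintP; rewrite divfK ?expf_neq0 ?pnatr_eq0// lexx ltr_nat leqnn. Qed.

Lemma measurable_dint I : measurable (@dint R I).
Proof. exact: measurable_itv. Qed.

Lemma mu_dint I : (@lebesgue_measure R) (@dint R I) = (dlen R I)%:E.
Proof.
rewrite /dint lebesgue_measure_itv /= lte_fin ltr_pM2r ?invr_gt0 ?exprn_gt0//.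
by rewrite ltr_nat leqnn -EFinB -mulrBl -natrB// subSnn mul1r.
Qed.

Lemma dsub_len I J : dsub R I J -> dlen R I <= dlen R J.
Proof.
move=> h; rewrite -lee_fin -!mu_dint; apply: le_measure => //;
  by rewrite inE; exact: measurable_dint.
Qed.

(** For the converse of [dle_dsub], comparing measures orders the levels, and the left endpoint of
    [I] is a common point. *)
Lemma dsubP I J : dsub R I J <-> dle I J.
Proof.
split=> [h|]; last exact: dle_dsub.
apply: dint_nested (dint_left I) (h _ (dint_left I)) _.
move/dsub_len: h; rewrite /dlen lef_pV2 ?posrE ?exprn_gt0//.
by rewrite ler_eXn2l ?ltr1n.
Qed.

Lemma dint_disj I J x : @dint R I x -> @dint R J x -> [\/ I = J, dlt I J | dlt J I].
Proof.
move=> h1 h2; case: (leqP (dlev J) (dlev I)) => h.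
  by case/dle_eqVlt: (dint_nested h1 h2 h); [constructor 1|constructor 2].
by case/dle_eqVlt: (dint_nested h2 h1 (ltnW h)) => [->|]; [constructor 1|constructor 3].
Qed.

Lemma measurable_dunion (L : set dyad) : measurable (@dunion R L).
Proof.
rewrite /dunion bigcup_mkcond; apply: countable_bigcupT_measurable => [|I].
  exact: countableP.
by case: ifP => _; [exact: measurable_dint|exact: measurable0].
Qed.

Lemma lmeas_ge0 (L : set dyad) : (0 <= lmeas R L)%E.
Proof. exact: measure_ge0. Qed.

Lemma lmeas_le (L : set dyad) J : (forall I, L I -> dle I J) ->
  (lmeas R L <= (dlen R J)%:E)%E.
Proof.
move=> h; rewrite -mu_dint; apply: le_measure; rewrite ?inE.
- exact: measurable_dunion.
- exact: measurable_dint.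
- by move=> x [I /h /dsubP hI] /hI.
Qed.

Lemma lmeas_fin (L : set dyad) : lmeas R L \is a fin_num.
Proof.
rewrite ge0_fin_numE ?lmeas_ge0//; apply: le_lt_trans (@lmeas_le L droot _) _.
  by move=> I _; exact: dle_root.
exact: ltry.
Qed.

Lemma lmeas_sub (L L' : set dyad) : @dunion R L `<=` @dunion R L' ->
  (lmeas R L <= lmeas R L')%E.
Proof.
by move=> h; apply: le_measure => //; rewrite inE; exact: measurable_dunion.
Qed.

(** Bounds on extended sums of nonnegative terms are tested on duplicate-free lists, which moves the
    estimates to finite sums. *)
Lemma esum_le_seqP (T : choiceType) (P : set T) (f : T -> R) (c : \bar R) :
  (forall i, P i -> 0 <= f i) ->
  (\esum_(i in P) (f i)%:E <= c)%E <->
  (forall s : seq T, uniq s -> (forall i, i \in s -> P i) ->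
     ((\sum_(i <- s) f i)%:E <= c)%E).
Proof.
move=> f0; split.
  move=> h s us sP; apply: le_trans h; apply: esum_ge.
  exists [set` s]; first by split => // i /sP.
  by rewrite -fsbig_seq// sumEFin.
move=> h; apply: ge_ereal_sup => _ /= [F [finF FP] <-].
rewrite fsbig_finite//= sumEFin; apply: h; first exact: finmap.fset_uniq.
by move=> i; rewrite in_fset_set// inE => /FP.
Qed.

(** Common shape of [carl] and [bmo_sq]: a bound on a supremum of averages becomes a family of
    inequalities between real numbers. *)
Lemma sup_average_leP (D : dyad -> set dyad) (w : dyad -> R) (c : R) :
  (forall I, 0 <= w I) ->
  (ereal_sup (range (fun J : dyad =>
     ((dlen R J)^-1)%:E * (\esum_(I in D J) (w I)%:E))) <= c%:E)%E <->
  (forall J (s : seq dyad), uniq s -> (forall I, I \in s -> D J I) ->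
     \sum_(I <- s) w I <= c * dlen R J).
Proof.
move=> w0; split.
  move=> h J s us sL.
  have h1 : (((dlen R J)^-1)%:E * (\esum_(I in D J) (w I)%:E) <= c%:E)%E.
    by apply: le_trans h; apply: ereal_sup_ubound; exists J.
  rewrite -lee_fin.
  have h2 : (\esum_(I in D J) (w I)%:E <= (c * dlen R J)%:E)%E.
    by rewrite muleC lee_pdivrMr ?dlen_gt0 in h1.
  by move/(esum_le_seqP _ (fun I _ => w0 I)): h2; apply.
move=> h; apply: ge_ereal_sup => _ [J _ <-].
rewrite muleC lee_pdivrMr ?dlen_gt0// -EFinM.
by apply/esum_le_seqP => // s us sP; rewrite lee_fin; exact: h.
Qed.

Lemma carl_leP (L : set dyad) (c : R) :
  (carl R L <= c%:E)%E <->
  (forall J (s : seq dyad), uniq s -> (forall I, I \in s -> L I /\ dle I J) ->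
     \sum_(I <- s) dlen R I <= c * dlen R J).
Proof.
split=> [/(sup_average_leP _ _ (@dlen_ge0)) h J s us sL|h].
  by apply: h => // I /sL[h1 h2]; split => //; apply/dsubP.
apply/(sup_average_leP _ _ (@dlen_ge0)) => J s us sL.
by apply: h => // I /sL[h1 /dsubP h2].
Qed.

Lemma bmo_sq_leP (x : dyad -> R) (c : R) :
  (bmo_sq x <= c%:E)%E <->
  (forall J (s : seq dyad), uniq s -> (forall I, I \in s -> dle I J) ->
     \sum_(I <- s) x I ^+ 2 * dlen R I <= c * dlen R J).
Proof.
have w0 I : 0 <= x I ^+ 2 * dlen R I by rewrite mulr_ge0 ?sqr_ge0 ?dlen_ge0.
split=> [/(sup_average_leP _ _ w0) h J s us sL|h].
  by apply: h => // I /sL h; apply/dsubP.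
apply/(sup_average_leP _ _ w0) => J s us sL.
by apply: h => // I /sL /dsubP.
Qed.

End DyadicReal.

(** Applied with [k] sending an interval to a maximal interval above it, or to its parent in a
    stopping tree. *)
Lemma sum_fiber (T T' : choiceType) (V : nmodType) (k : T -> T') (s : seq T) (f : T -> V) :
  \sum_(I <- s) f I = \sum_(K <- undup (map k s)) \sum_(I <- s | k I == K) f I.
Proof.
rewrite (exchange_big_dep xpredT)//= [LHS]big_seq [RHS]big_seq.
apply: eq_bigr => I Is; rewrite -big_filter (bigD1_seq (k I)) /=.
- rewrite big_seq_cond big_pred0 ?addr0// => K; rewrite mem_filter.
  by apply/negP => /andP[/andP[/eqP -> _]]; rewrite eqxx.
- by rewrite mem_filter eqxx mem_undup map_f.
- by rewrite filter_uniq// undup_uniq.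
Qed.

Section Measure.
Variable R : realType.
Implicit Types (I J K Q : dyad) (L : set dyad) (s : seq dyad).

Lemma sum_mu_le s (F : dyad -> set R) (X : set R) : uniq s ->
  (forall I, measurable (F I)) -> trivIset [set` s] F -> measurable X ->
  (forall I, I \in s -> F I `<=` X) ->
  (\sum_(I <- s) (@lebesgue_measure R) (F I) <= (@lebesgue_measure R) X)%E.
Proof.
move=> us mF tF mX FX.
rewrite fsbig_seq// -measure_fin_bigcup//; last by move=> I _; exact: mF.
apply: le_measure; rewrite ?inE//.
  by apply: fin_bigcup_measurable => // I _; exact: mF.
by move=> x [I /= /FX]; apply.
Qed.

Definition antichain L := forall I J, L I -> L J -> dle I J -> I = J.

Lemma antichain_sum L s : antichain L -> uniq s -> (forall I, I \in s -> L I) ->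
  ((\sum_(I <- s) dlen R I)%:E <= lmeas R L)%E.
Proof.
move=> aL us sL; rewrite -sumEFin.
under eq_bigr do rewrite -mu_dint.
apply: sum_mu_le => //.
- by move=> I; exact: measurable_dint.
- move=> I J /= /sL hI /sL hJ [x [xI xJ]].
  case: (dint_disj xI xJ) => // /dltW h; first exact: aL.
  by apply/esym; exact: aL.
- exact: measurable_dunion.
- by move=> I /sL hI x xI; exists I.
Qed.

Lemma dmax_sub L I : dmax R L I -> L I.
Proof. by case. Qed.

Lemma antichain_dmax L : antichain (dmax R L).
Proof. by move=> I J [LI hI] [LJ hJ] h; apply/esym/hI => //; apply/dsubP. Qed.

(** Among the finitely many ancestors of [I], the one in [L] of smallest level is maximal. *)
Lemma dmaxP L I : L I -> exists2 K, dmax R L K & dle I K.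
Proof.
move=> LI; have ex : exists m, (m <= dlev I)%N && `[< L (danc I m) >].
  by exists (dlev I); rewrite leqnn danc_id; apply/asboolP.
case: (ex_minnP ex) => m /andP[hm /asboolP hL] hmin.
exists (danc I m); last exact: dle_danc.
split => // K LK /dsubP hK; apply/esym/(dle_lev_eq hK).
have := dle_lev hK; rewrite dlev_danc => h.
apply/eqP; rewrite eqn_leq h andbT; apply: hmin; rewrite (leq_trans h hm)/=.
have := dle_trans (dle_danc hm) hK; case/andP => _ /eqP ->.
exact/asboolP.
Qed.

Lemma dunion_dmax L : dunion (dmax R L) = @dunion R L.
Proof.
apply/seteqP; split => x [I hI xI]; first by exists I => //; exact: dmax_sub hI.
have [K hK /dsubP hIK] := dmaxP hI.
by exists K => //; exact: hIK.
Qed.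

Lemma lmeas_dmax L : lmeas R (dmax R L) = lmeas R L.
Proof. by rewrite /lmeas dunion_dmax. Qed.

Lemma lmeas_le_esum L : (lmeas R L <= \esum_(I in L) (dlen R I)%:E)%E.
Proof.
(* Slicing [L] by codes gives a sequence of collections with at most one interval each, to which
   countable subadditivity applies. *)
pose Jn n := [set I | L I /\ pickle I = n].
have LE : L = \bigcup_n Jn n.
  apply/seteqP; split => [I LI|I [n _ []//]].
  by exists (pickle I).
rewrite [X in (_ <= \esum_(I in X) _)%E]LE esum_bigcupT; first last.
- by move=> I; rewrite lee_fin dlen_ge0.
- by move=> i j _ _ [I [[_ <-] [_ <-]]].
rewrite -nneseries_esumT; last first.
  by move=> n; apply: esum_ge0 => I _; rewrite lee_fin dlen_ge0.
apply: (@le_trans _ _ (\sum_(0 <= n <oo) lmeas R (Jn n))%E).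
  apply: measure_sigma_subadditive.
  - by move=> n; exact: measurable_dunion.
  - exact: measurable_dunion.
  - move=> x [I LI xI]; exists (pickle I) => //.
    by exists I.
apply: lee_nneseries => [n _ _|n _]; first exact: lmeas_ge0.
have [[I [LI hI]]|N] := pselect (exists I, Jn n I).
  have -> : Jn n = [set I].
    apply/seteqP; split => [K [LK hK]/=|K -> //].
    by apply: (pcan_inj pickleK); rewrite hK.
  rewrite esum_set1 ?lee_fin ?dlen_ge0// -mu_dint.
  by rewrite /lmeas /dunion bigcup_set1.
have -> : Jn n = set0.
  by rewrite -subset0 => I hI; apply: N; exists I.
by rewrite /lmeas /dunion bigcup_set0 measure0 esum_set0.
Qed.

(** The Carleson bound is used inside each maximal interval of [L]; the maximal intervals are
    disjoint and have the same union as [L]. *)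
Lemma carl_lmeas L (c : R) s : (carl R L <= c%:E)%E -> uniq s ->
  (forall I, I \in s -> L I) ->
  ((\sum_(I <- s) dlen R I)%:E <= c%:E * lmeas R L)%E.
Proof.
case: s => [|I0 s0] hc us sL.
  (* A negative [c] is impossible: already the empty list would violate the bound on [droot]. *)
  rewrite big_nil; case: (leP 0 c) => c0; first by rewrite mule_ge0 ?lee_fin// lmeas_ge0.
  have /carl_leP/(_ droot [::] isT) := hc.
  rewrite big_nil => /(_ (fun _ => ltac:(done))).
  by rewrite pmulr_lge0 ?dlen_gt0 // leNgt c0.
have c0 : 0 <= c.
  have /carl_leP/(_ I0 [:: I0] isT) := hc.
  rewrite big_seq1 => h; rewrite -(pmulr_lge0 _ (dlen_gt0 R I0)).
  apply: le_trans (dlen_ge0 R I0) (h _) => I; rewrite inE => /eqP ->.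
  by split; [apply: sL; rewrite inE eqxx|exact: dle_refl].
move: (I0 :: s0) us sL => s us sL.
have /choice[k hk] : forall I, exists K, L I -> dmax R L K /\ dle I K.
  move=> I; have [LI|N] := pselect (L I); last by exists I.
  by have [K] := dmaxP LI; exists K.
rewrite (sum_fiber k).
apply: (@le_trans _ _ (\sum_(K <- undup (map k s)) c * dlen R K)%:E).
  rewrite lee_fin; apply: ler_sum => K _.
  rewrite -big_filter.
  move/carl_leP : hc; apply; first exact: filter_uniq.
  move=> I; rewrite mem_filter => /andP[/eqP <- /sL LI]; split => //.
  by case: (hk _ LI).
rewrite -mulr_sumr EFinM; apply: lee_wpmul2l; first by rewrite lee_fin.
rewrite -lmeas_dmax; apply: antichain_sum.
- exact: antichain_dmax.
- exact: undup_uniq.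
- by move=> K; rewrite mem_undup => /mapP[I /sL LI ->]; case: (hk _ LI).
Qed.

Lemma carl_antichain L : antichain L -> (carl R L <= 1%:E)%E.
Proof.
move=> aL; apply/carl_leP => J s us sL; rewrite mul1r -lee_fin.
apply: le_trans (@lmeas_le R [set I | L I /\ dle I J] J _); last by move=> I [].
by apply: antichain_sum => // I K [h1 _] [h2 _]; exact: aL.
Qed.

Lemma carl_sub L L' : L `<=` L' -> (carl R L <= carl R L')%E.
Proof.
move=> h; apply: ge_ereal_sup => _ [J _ <-].
apply: le_trans (ereal_sup_ubound _); last by exists J.
rewrite lee_pmul2l ?lte_fin ?invr_gt0 ?dlen_gt0//.
apply: ge_ereal_sup => _ /= [F [finF FP] <-].
apply: ereal_sup_ubound; exists F => //; split => // I /FP[h1 h2]; split => //.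
exact: h.
Qed.

Lemma carl_ge0 L : (0 <= carl R L)%E.
Proof.
apply: le_trans (ereal_sup_ubound _); last by exists droot.
apply: mule_ge0; first by rewrite lee_fin invr_ge0 dlen_ge0.
by apply: esum_ge0 => I _; rewrite lee_fin dlen_ge0.
Qed.

Lemma carl_ge1 L I : L I -> (1 <= carl R L)%E.
Proof.
move=> LI; rewrite leNgt; apply/negP => h.
have f : carl R L \is a fin_num by rewrite ge0_fin_numE ?carl_ge0// (lt_trans h)// ltry.
have /carl_leP/(_ I [:: I] isT) : (carl R L <= (fine (carl R L))%:E)%E by rewrite fineK.
rewrite big_seq1 => hI.
have : dlen R I <= fine (carl R L) * dlen R I.
  by apply: hI => K; rewrite inE => /eqP ->; split => //; exact: dle_refl.
rewrite -{1}(mul1r (dlen R I)) ler_pM2r ?dlen_gt0//.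
by rewrite -lee_fin fineK// leNgt h.
Qed.

End Measure.

(** * Layers of a Carleson weight *)

Lemma ler_sum_subset (R : numDomainType) (T : eqType) (s t : seq T) (f : T -> R) :
  uniq s -> uniq t -> {subset s <= t} -> (forall I, 0 <= f I) ->
  \sum_(I <- s) f I <= \sum_(I <- t) f I.
Proof.
move=> us ut st f0; rewrite [leRHS](bigID (mem s)) /=.
have e : perm_eq s [seq I <- t | I \in s].
  apply: uniq_perm => //; first exact: filter_uniq.
  by move=> I; rewrite mem_filter; case Is : (I \in s) => //=; rewrite st.
rewrite (perm_big _ e) big_filter -lerBDl subrr.
by rewrite sumr_ge0.
Qed.

Lemma sum_mem_size (N : nat) (s : seq nat) : uniq s -> (forall j, j \in s -> (j < N)%N) ->
  (\sum_(j < N) ((j : nat) \in s) = size s)%N.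
Proof.
move=> us sN; rewrite -(big_mkord xpredT (fun j => nat_of_bool (j \in s))).
rewrite -big_mkcond /= sum1_count -size_filter; apply: perm_size.
apply: uniq_perm => //; first by rewrite filter_uniq// iota_uniq.
move=> j; rewrite mem_filter mem_index_iota /=.
by case: (boolP (j \in s)) => //= /sN ->.
Qed.

Definition load (n : dyad -> nat) (I : dyad) : nat := \sum_(m < dlev I) n (danc I m).

(* Stacking the weights of the intervals containing [I] from [droot] downwards,
   [I] occupies the integers [load n I <= p < load n I + n I]; it belongs to the
   layers [p %% N]. *)
Definition layer (n : dyad -> nat) (N j : nat) : pred dyad :=
  fun I => j \in [seq (p %% N)%N | p <- iota (load n I) (n I)].

Lemma load_child (n : dyad -> nat) b J : load n (dchild b J) = (load n J + n J)%N.
Proof.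
rewrite /load dlev_child big_ord_recr /= danc_child// danc_id; congr (_ + _)%N.
by apply: eq_bigr => m _; rewrite danc_child// ltnW.
Qed.

(** With [c = N - 1 - j], the quotient [(p + c) %/ N] counts the integers below [p] congruent to [j]
    modulo [N]. From [p = load n J] to [p = load n J + n J] it grows by at least one if [J] is in
    layer [j]. *)
Lemma layer_step (n : dyad -> nat) (N j : nat) J : (j < N)%N ->
  (N * layer n N j J + (load n J + n J + (N - 1 - j)) %% N <=
   n J + (load n J + (N - 1 - j)) %% N)%N.
Proof.
move=> jN; have N0 : (0 < N)%N by exact: leq_ltn_trans jN.
set c := (N - 1 - j)%N; set S := load n J.
(* Both quotients are added so that each remainder completes to its dividend. *)
rewrite -(leq_add2l (N * ((S + c) %/ N) + N * ((S + n J + c) %/ N))).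
have e1 := divn_eq (S + c) N; have e2 := divn_eq (S + n J + c) N.
suff : (N * layer n N j J + N * ((S + c) %/ N) <= N * ((S + n J + c) %/ N))%N by lia.
rewrite -mulnDr leq_pmul2l//.
case: (boolP (layer n N j J)) => [/mapP[p]|_] /=; last first.
  by rewrite add0n leq_div2r// leq_add2r leq_addr.
rewrite mem_iota -/S => /andP[h1 h2] h3.
have e3 := divn_eq p N; rewrite -h3 in e3.
have : ((S + c) %/ N < (p %/ N).+1)%N by rewrite ltn_divLR//; lia.
have : ((p %/ N).+1 <= (S + n J + c) %/ N)%N by rewrite leq_divRL//; lia.
by lia.
Qed.

Section Splitting.
Variable R : realType.
Implicit Types (I J K Q : dyad) (L : set dyad) (s t : seq dyad).

(** The remainder in [layer_step] is a potential. The two children of [J] have the same load and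
    together the length of [J], so the inequality telescopes down the levels. *)
Lemma layer_potential (n : dyad -> nat) (N j : nat) : (j < N)%N -> forall k J,
  N%:R * (\sum_(I <- ddesc k J | layer n N j I) dlen R I) <=
  \sum_(I <- ddesc k J) (n I)%:R * dlen R I +
  ((load n J + (N - 1 - j)) %% N)%:R * dlen R J.
Proof.
move=> jN; elim=> [|k IH] J.
  by rewrite !big_nil mulr0 add0r mulr_ge0 ?dlen_ge0.
rewrite /= !big_cons !big_cat /=.
have := IH (dchild false J); have := IH (dchild true J).
rewrite !load_child !dlen_child.
have := layer_step n J jN; set r := (_ %% N)%N; set r' := (_ %% N)%N => h.
have {h} : N%:R * (layer n N j J)%:R + r%:R <= (n J)%:R + r'%:R :> R.
  by rewrite -natrM -!natrD ler_nat.
have := dlen_gt0 R J; set d := dlen R J.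
have -> : (if layer n N j J then
   d + (\sum_(I <- ddesc k (dchild false J) | layer n N j I) dlen R I +
        \sum_(I <- ddesc k (dchild true J) | layer n N j I) dlen R I)
   else (\sum_(I <- ddesc k (dchild false J) | layer n N j I) dlen R I +
        \sum_(I <- ddesc k (dchild true J) | layer n N j I) dlen R I)) =
   (layer n N j J)%:R * d + (\sum_(I <- ddesc k (dchild false J) | layer n N j I) dlen R I +
        \sum_(I <- ddesc k (dchild true J) | layer n N j I) dlen R I).
  by case: (layer n N j J); rewrite ?mul1r ?mul0r ?add0r.
move: (\sum_(I <- ddesc k (dchild false J) | _) _) (\sum_(I <- ddesc k (dchild true J) | _) _).
move: (\sum_(I <- ddesc k (dchild false J)) _) (\sum_(I <- ddesc k (dchild true J)) _).
move: (layer n N j J)%:R => b x1 x2 y1 y2 d0 h h1 h2.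
have : (N%:R * b + r%:R) * d <= ((n J)%:R + r'%:R) * d by rewrite ler_pM2r.
by move: h1 h2; lra.
Qed.

(** The potential is less than [N], so it adds at most [N * dlen R J] to the bound on the weights:
    hence the constant 2. *)
Lemma layer_carl (n : dyad -> nat) (N j : nat) : (j < N)%N ->
  (forall k J, \sum_(I <- ddesc k J) (n I)%:R * dlen R I <= N%:R * dlen R J) ->
  (carl R [set` layer n N j] <= 2%:E)%E.
Proof.
move=> jN hn; apply/carl_leP => J s us sL.
(* This depth is large enough for [ddesc k J] to contain all of [s]. *)
pose k := (\max_(I <- s) dlev I).+1.
have N0 : 0 < N%:R :> R by rewrite ltr0n; exact: leq_ltn_trans jN.
apply: (@le_trans _ _ (\sum_(I <- ddesc k J | layer n N j I) dlen R I)).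
  rewrite -[leRHS]big_filter; apply: ler_sum_subset => //.
  - by rewrite filter_uniq// uniq_ddesc.
  - move=> I Is; have [hI hJ] := sL _ Is.
    rewrite mem_filter mem_ddesc hJ; apply/andP; split; first exact: hI.
    by rewrite /k addnS ltnS; apply: leq_trans (leq_addl _ _); exact: leq_bigmax_seq.
  - by move=> I; exact: dlen_ge0.
rewrite -(ler_pM2l N0); apply: le_trans (layer_potential n jN k J) _.
have -> : N%:R * (2 * dlen R J) = N%:R * dlen R J + N%:R * dlen R J by ring.
apply: lerD; first exact: hn.
by rewrite ler_pM2r ?dlen_gt0// ler_nat ltnW// ltn_mod; exact: leq_ltn_trans jN.
Qed.

(** At most [N] consecutive integers have distinct residues modulo [N]. *)
Lemma layer_count (n : dyad -> nat) (N : nat) I : (n I <= N)%N ->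
  (\sum_(j < N) layer n N j I = n I)%N.
Proof.
move=> nN; rewrite sum_mem_size ?size_map ?size_iota//; last first.
  move=> j /mapP[p]; rewrite mem_iota => hp ->; rewrite ltn_mod.
  by apply: leq_trans nN; move: hp; lia.
rewrite map_inj_in_uniq ?iota_uniq// => p q; rewrite !mem_iota => hp hq e.
have := divn_eq p N; have := divn_eq q N; rewrite e.
case: (ltngtP (p %/ N) (q %/ N)) => [h|h|->]; last by move=> <-.
  by have := leq_mul h (leqnn N); lia.
by have := leq_mul h (leqnn N); lia.
Qed.

(** Intermediate property: it follows from (ii) and from (iii), and it implies (i). The threshold 2
    is the constant of [layer_carl]. *)
Definition sparse_bounded (tau : dyad -> dyad) (C : R) :=
  forall L, (carl R L <= 2%:E)%E -> (carl R (tau @` L) <= C%:E)%E.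

Lemma sparse_bounded_ge1 tau C : sparse_bounded tau C -> 1 <= C.
Proof.
move=> h.
have h1 : (1%:E <= carl R (tau @` [set droot]))%E.
  by apply: (@carl_ge1 R _ (tau droot)); exists droot.
have h2 : (carl R (tau @` [set droot]) <= C%:E)%E.
  apply: h; apply: le_trans (carl_antichain R _) _; last by rewrite lee_fin ler1n.
  by move=> I J /= -> ->.
by have := le_trans h1 h2; rewrite lee_fin.
Qed.

Lemma sparse_sum tau C L J s : injective tau -> sparse_bounded tau C ->
  (carl R L <= 2%:E)%E -> uniq s -> (forall I, I \in s -> L I /\ dle (tau I) J) ->
  \sum_(I <- s) dlen R (tau I) <= C * dlen R J.
Proof.
move=> ti h /h /carl_leP hL us sP.
rewrite -(big_map tau xpredT (dlen R)); apply: hL; first by rewrite map_inj_uniq.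
by move=> K /mapP[I /sP[h1 h2] ->]; split => //; exists I.
Qed.

(** The weight is the sum of the indicators of its [N] layers, and each layer is 2-Carleson. *)
Lemma weighted_sum tau C (n : dyad -> nat) (N : nat) J t : injective tau ->
  sparse_bounded tau C ->
  (forall k J, \sum_(I <- ddesc k J) (n I)%:R * dlen R I <= N%:R * dlen R J) ->
  uniq t -> (forall I, I \in t -> dle (tau I) J) ->
  \sum_(I <- t) (n I)%:R * dlen R (tau I) <= N%:R * (C * dlen R J).
Proof.
move=> ti hC hn ut tJ.
have nN I : (n I <= N)%N.
  have := hn 1%N I; rewrite /= big_seq1 ler_pM2r ?dlen_gt0//.
  by rewrite ler_nat.
under eq_bigr do rewrite -(layer_count (nN _)) natr_sum mulr_suml.
rewrite exchange_big /= mulr_natl -[X in _ *+ X]card_ord -sumr_const.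
apply: ler_sum => j _.
rewrite (eq_bigr (fun I => if layer n N j I then dlen R (tau I) else 0)); last first.
  by move=> I _; case: (layer _ _ _ _); rewrite ?mul1r ?mul0r.
rewrite -big_mkcond -big_filter.
apply: (sparse_sum ti hC (layer_carl (ltn_ord j) hn)); first exact: filter_uniq.
by move=> I; rewrite mem_filter => /andP[h1 /tJ].
Qed.

(** * The induced operator on BMO *)

Lemma Top_tau tau (x : dyad -> R) I : injective tau -> Top tau x (tau I) = x I.
Proof.
move=> ti; rewrite /Top; case: pselect => [H|[]]; last by exists I.
by congr x; apply: ti; exact: (proj2_sig (cid H)).
Qed.

Lemma Top_out tau (x : dyad -> R) K : ~ (exists I, tau I = K) -> Top tau x K = 0.
Proof. by rewrite /Top; case: pselect. Qed.

(** Coefficients outside the range of [tau] vanish, so a sum over subintervals of [J] pulls back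
    along [tau]. *)
Lemma bmo_Top_le tau (x : dyad -> R) (c : R) : injective tau ->
  (forall J t, uniq t -> (forall I, I \in t -> dle (tau I) J) ->
    \sum_(I <- t) x I ^+ 2 * dlen R (tau I) <= c * dlen R J) ->
  (bmo_sq (Top tau x) <= c%:E)%E.
Proof.
move=> ti h; apply/bmo_sq_leP => J s us sJ.
have /choice[g hg] : forall K, exists I, (exists I', tau I' = K) -> tau I = K.
  by move=> K; have [[I hI]|N] := pselect (exists I', tau I' = K); [exists I|exists K].
pose rng K := `[< exists I, tau I = K >].
rewrite (bigID rng) /= [X in _ + X]big1 ?addr0; last first.
  by move=> K /asboolPn /Top_out ->; rewrite expr0n mul0r.
rewrite -big_filter; set s' := [seq K <- s | rng K].
have s'g K : K \in s' -> tau (g K) = K.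
  by rewrite mem_filter => /andP[/asboolP /hg].
rewrite big_seq (eq_bigr (fun K => x (g K) ^+ 2 * dlen R (tau (g K)))); last first.
  by move=> K Ks; rewrite s'g// -{1}(s'g _ Ks) Top_tau.
rewrite -big_seq -(big_map g xpredT (fun I => x I ^+ 2 * dlen R (tau I))).
apply: h.
  rewrite map_inj_in_uniq ?filter_uniq// => K K' hK hK' e.
  by rewrite -(s'g _ hK) -(s'g _ hK') e.
move=> I /mapP[K Ks ->]; rewrite s'g//; apply: sJ.
by move: Ks; rewrite mem_filter => /andP[].
Qed.

Lemma sparse_bounded_BMO tau C : injective tau -> sparse_bounded tau C ->
  T_bounded_BMO R tau.
Proof.
move=> ti hC; have C1 := sparse_bounded_ge1 hC.
have C0 : 0 < C by exact: lt_le_trans ltr01 C1.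
(* [T_bounded_BMO] compares squared norms with the square of its constant, hence the root. *)
exists (Num.sqrt C) => x xfin; rewrite sqr_sqrtr ?(ltW C0)//.
have b0 : (0 <= bmo_sq x)%E.
  apply: le_trans (ereal_sup_ubound _); last by exists droot.
  apply: mule_ge0; first by rewrite lee_fin invr_ge0 dlen_ge0.
  by apply: esum_ge0 => I _; rewrite lee_fin mulr_ge0 ?sqr_ge0// dlen_ge0.
have bf : bmo_sq x \is a fin_num by rewrite ge0_fin_numE.
have := fineK bf; move: (fine _) => b bE.
rewrite -bE in b0 *; rewrite lee_fin in b0; rewrite -EFinM.
apply/lee_addgt0Pr => e e0; rewrite -EFinD.
(* The slack [e / C] makes [a] positive even if the norm of [x] vanishes, so that division by [a] is
   legitimate. *)
pose a := b + e / C; have a0 : 0 < a by rewrite ltr_wpDl// divr_gt0.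
have -> : C * b + e = C * a by rewrite /a mulrDr mulrC [C * (_ / _)]mulrC divfK ?gt_eqF.
have /bmo_sq_leP ha : (bmo_sq x <= a%:E)%E.
  by rewrite -bE lee_fin lerDl divr_ge0// ltW.
apply: bmo_Top_le => // J t ut tJ.
pose A := \sum_(I <- t) dlen R (tau I).
have A0 : 0 <= A by apply: sumr_ge0 => I _; exact: dlen_ge0.
apply/ler_addgt0Pr => d d0.
(* Rounding will cost at most [a * A] in total; after division by this [N] the cost is at most
   [d]. *)
pose N := (Num.bound (a * A / d)).+1.
have N0 : 0 < N%:R :> R by rewrite ltr0n.
have hN : a * A <= N%:R * d.
  rewrite -ler_pdivrMr//; apply: ltW; apply: lt_trans (archi_boundP _) _.
    by rewrite divr_ge0 ?mulr_ge0// ltW.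
  by rewrite ltr_nat.
(* Rounding down preserves the Carleson bound with constant [N], and [N * x I ^+ 2] exceeds
   [a * n I] by less than [a]. *)
pose n I := Num.trunc (N%:R * x I ^+ 2 / a).
have w0 I : 0 <= N%:R * x I ^+ 2 / a.
  by apply: divr_ge0; [apply: mulr_ge0; [exact: ler0n|exact: sqr_ge0]|exact: ltW].
have hn : forall k J, \sum_(I <- ddesc k J) (n I)%:R * dlen R I <= N%:R * dlen R J.
  move=> k Q; have := ha Q (ddesc k Q) (uniq_ddesc k Q).
  have sQ I : I \in ddesc k Q -> dle I Q by rewrite mem_ddesc => /andP[].
  move=> /(_ sQ) h.
  apply: (@le_trans _ _ (\sum_(I <- ddesc k Q) (N%:R / a) * (x I ^+ 2 * dlen R I))).
    apply: ler_sum => I _; rewrite mulrA ler_pM2r ?dlen_gt0//.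
    have : (n I)%:R <= N%:R * x I ^+ 2 / a by rewrite truncn_le.
    by rewrite mulrAC.
  by rewrite -mulr_sumr -mulrA ler_pM2l// ler_pdivrMl.
have hw := weighted_sum ti hC hn ut tJ.
have : N%:R * (\sum_(I <- t) x I ^+ 2 * dlen R (tau I)) <=
    a * (\sum_(I <- t) (n I)%:R * dlen R (tau I)) + a * A.
  rewrite /A !mulr_sumr -big_split /=; apply: ler_sum => I _.
  have : N%:R * x I ^+ 2 / a <= (n I).+1%:R by apply: ltW; exact: truncnS_gt.
  rewrite ler_pdivrMr// => h.
  have := ler_wpM2r (dlen_ge0 R (tau I)) h.
  by rewrite -natr1; lra.
move=> h; rewrite -(ler_pM2l N0); apply: le_trans h _.
have := ler_wpM2l (ltW a0) hw; move: hN; lra.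
Qed.

End Splitting.

(** * Testing on indicators; sparse bounds from the weak-Property P *)

Lemma image_seq (T T' : choiceType) (f : T -> T') (A : set T) (s : seq T') :
  uniq s -> (forall y, y \in s -> (f @` A) y) ->
  exists t, [/\ uniq t, (forall x, x \in t -> A x) & s = map f t].
Proof.
elim: s => [|y s IH] /=; first by move=> _ _; exists [::].
move=> /andP[ys us] h.
have [t [ut tA sE]] : exists t, [/\ uniq t, (forall x, x \in t -> A x) & s = map f t].
  by apply: IH => // z zs; apply: h; rewrite inE zs orbT.
have [x Ax fx] : (f @` A) y by apply: h; rewrite inE eqxx.
exists (x :: t); split => /=; last by rewrite fx sE.
  by rewrite ut andbT; apply: contra ys => xt; rewrite sE -fx map_f.
by move=> z; rewrite inE => /predU1P[->|/tA].
Qed.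

Section Implications.
Variable R : realType.
Implicit Types (I J K Q : dyad) (L : set dyad) (s t : seq dyad).

Lemma BMO_bounded_carl tau : injective tau -> T_bounded_BMO R tau ->
  exists M : R, 1 <= M /\ forall L, (carl R (tau @` L) <= M%:E * carl R L)%E.
Proof.
(* The maximum with 1 also keeps the factor positive, so that the right side is infinite when
   [carl R L] is. *)
move=> ti [C hC]; exists (Num.max 1 (C ^+ 2)); split; first by rewrite le_max lexx.
move=> L; have M0 : 0 < Num.max 1 (C ^+ 2) by rewrite lt_max ltr01.
(* The value 0 forces [L] to be empty, since a single interval already gives at least 1. *)
have := carl_ge0 R L; rewrite le_eqVlt => /predU1P[c0|].
  rewrite -c0 mule0; apply/carl_leP => J s us sL.
  case: s us sL => [|K s] _ sL; first by rewrite big_nil mul0r.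
  have [|[I /(@carl_ge1 R) LI _] _] := sL K; first by rewrite mem_head.
  by move: LI; rewrite -c0 lee_fin ler10.
case: (boolP (carl R L \is a fin_num)) => [cf c0|]; last first.
  rewrite ge0_fin_numE ?carl_ge0// -leNgt leye_eq => /eqP -> _.
  by rewrite mulry gtr0_sg// mul1e leey.
have := fineK cf; move: (fine _) => c cE; rewrite -cE.
pose x I : R := (I \in L)%:R.
have hx : (bmo_sq x <= c%:E)%E.
  apply/bmo_sq_leP => J s us sJ.
  rewrite (eq_bigr (fun I => if I \in L then dlen R I else 0)); last first.
    by move=> I _; rewrite /x; case: (I \in L); rewrite ?expr1n ?mul1r ?expr0n ?mul0r.
  rewrite -big_mkcond -big_filter.
  have /carl_leP : (carl R L <= c%:E)%E by rewrite cE.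
  apply; first exact: filter_uniq.
  by move=> I; rewrite mem_filter => /andP[/set_mem LI /sJ].
have hT : (bmo_sq (Top tau x) <= (C ^+ 2 * c)%:E)%E.
  apply: le_trans (hC x _) _; first by rewrite (le_lt_trans hx)// ltry.
  by rewrite [leRHS]EFinM lee_wpmul2l// lee_fin sqr_ge0.
have cge : 0 <= c by rewrite -lee_fin cE ltW.
apply: (@le_trans _ _ (C ^+ 2 * c)%:E); last first.
  by rewrite -EFinM lee_fin ler_wpM2r// le_max lexx orbT.
apply/carl_leP => J s us sL.
have sJ K : K \in s -> dle K J by case/sL.
move/bmo_sq_leP : hT => /(_ J s us sJ); apply: le_trans.
rewrite big_seq [leRHS]big_seq; apply: ler_sum => K /sL[[I LI <-] _].
by rewrite Top_tau// /x mem_set// expr1n mul1r.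
Qed.

Lemma esum_le_carl L J (c : R) : (carl R L <= c%:E)%E -> (forall I, L I -> dle I J) ->
  (\esum_(I in L) (dlen R I)%:E <= (c * dlen R J)%:E)%E.
Proof.
move=> /carl_leP h hJ; apply/esum_le_seqP => [I _|s us sL]; first exact: dlen_ge0.
by rewrite lee_fin; apply: h => // I /sL LI; split => //; exact: hJ.
Qed.

Lemma sum_le_esum L s : uniq s -> (forall I, I \in s -> L I) ->
  ((\sum_(I <- s) dlen R I)%:E <= \esum_(I in L) (dlen R I)%:E)%E.
Proof.
move=> us sL.
by have /(esum_le_seqP _ (fun I _ => dlen_ge0 R I)) := le_refl (\esum_(I in L) (dlen R I)%:E)%E; apply.
Qed.

Lemma lmeas_gt0 L I : L I -> 0 < fine (lmeas R L).
Proof.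
move=> LI; apply: lt_le_trans (dlen_gt0 R I) _.
rewrite -lee_fin fineK ?lmeas_fin// -mu_dint; apply: le_measure; rewrite ?inE.
- exact: measurable_dint.
- exact: measurable_dunion.
- by move=> x xI; exists I.
Qed.

(** The lengths in [L] add up to at most [c] times the measure of the union of [L], by [carl_lmeas];
    this measure cancels against the denominator in the ratio bound. *)
Lemma image_esum_le tau L (b c M : R) : 0 <= M -> 0 <= b -> 0 <= c ->
  (carl R L <= c%:E)%E ->
  (forall I, L I -> dlen R (tau I) / dlen R I <= M * b / fine (lmeas R L)) ->
  (\esum_(K in tau @` L) (dlen R K)%:E <= (M * b * c)%:E)%E.
Proof.
move=> M0 b0 c0 hc hM; apply/esum_le_seqP => [I _|s us sL]; first exact: dlen_ge0.
have [t [ut tL ->]] := image_seq us sL; rewrite big_map lee_fin.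
case: t ut tL => [|I0 t0]; first by rewrite big_nil !mulr_ge0.
move: (mem_head I0 t0); move: (I0 :: t0) => t I0t ut tL.
have a0 := lmeas_gt0 (tL _ I0t).
have h1 : \sum_(I <- t) dlen R I <= c * fine (lmeas R L).
  by rewrite -lee_fin EFinM fineK ?lmeas_fin//; exact: carl_lmeas.
set a := fine _ in hM a0 h1.
apply: (@le_trans _ _ (\sum_(I <- t) (M * b / a) * dlen R I)).
  rewrite big_seq [leRHS]big_seq; apply: ler_sum => I /tL /hM.
  by rewrite ler_pdivrMr ?dlen_gt0.
rewrite -mulr_sumr.
apply: (@le_trans _ _ (M * b / a * (c * a))).
  by apply: ler_wpM2l h1; rewrite divr_ge0 ?mulr_ge0// ltW.
by rewrite le_eqVlt; apply/orP; left; apply/eqP; field; rewrite gt_eqF.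
Qed.

Lemma weak_P_sparse tau : injective tau -> weak_property_P R tau ->
  exists C : R, sparse_bounded tau C.
Proof.
move=> ti [M [M0 hP]]; exists (2 * M * (3 * M) + M) => L hL.
apply/carl_leP => J s us sL.
have [A [E [hD [dA [dE [_ [hE [hb hc]]]]]]]] := hP L J.
have inJ K : dcapJ R (tau @` L) J K <-> (tau @` L) K /\ dle K J.
  by split=> -[h1 /dsubP h2].
have AL i : A i `<=` L.
  move=> I AI; have : dcapJ R (tau @` L) J (tau I).
    by rewrite hD; left; exists i => //; exists I.
  by case/inJ => -[I' LI' /ti <-].
have EJ i K : E i K -> dle K J.
  by move=> EK; have /inJ[] : dcapJ R (tau @` L) J K by rewrite hD; right; exists i.
pose UE := \bigcup_(i in [set: nat]) E i; pose UA := \bigcup_(i in [set: nat]) (tau @` A i).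
have sE : (\esum_(K in UE) (dlen R K)%:E <= (M * dlen R J)%:E)%E.
  by apply: esum_le_carl => // K [i _ /EJ].
have dl0 K : (0 <= (dlen R K)%:E)%E by rewrite lee_fin dlen_ge0.
have es0 (B : set dyad) : (0 <= \esum_(K in B) (dlen R K)%:E)%E by apply: esum_ge0.
have ltE : (\sum_(0 <= i <oo) lmeas R (E i) <= (M * dlen R J)%:E)%E.
  apply: le_trans sE; rewrite esum_bigcupT//; last first.
    by move=> i j _ _ [K [h1 h2]]; apply: contrapT => ij; have := dE _ _ ij;
      rewrite -subset0 => /(_ K); apply.
  rewrite -nneseries_esumT//.
  by apply: lee_nneseries => [i _ _|i _]; [exact: lmeas_ge0|exact: lmeas_le_esum].
have ltA : (\sum_(0 <= i <oo) lmeas R (tau @` A i) <= (M * dlen R J * 2)%:E)%E.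
  apply: le_trans hc _; rewrite [leRHS]EFinM; apply: lee_wpmul2l.
    by rewrite lee_fin mulr_ge0 ?dlen_ge0// ltW.
  (* By injectivity the preimage of the maximal intervals lies in [A i], hence in the 2-Carleson
     [L]. *)
  apply: ge_ereal_sup => _ [i _ <-]; apply: le_trans hL; apply: carl_sub.
  by move=> I [[I' /AL LI' /ti <-]].
have sA : (\esum_(K in UA) (dlen R K)%:E <= (2 * M * (3 * M * dlen R J))%:E)%E.
  rewrite esum_bigcupT//; last first.
    by move=> i j _ _ [K [h1 h2]]; apply: contrapT => ij; have := dA _ _ ij;
      rewrite -subset0 => /(_ K); apply.
  rewrite -nneseries_esumT//.
  apply: (@le_trans _ _ (\sum_(0 <= i <oo)
      ((2 * M)%:E * (lmeas R (tau @` A i) + lmeas R (E i))))%E).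
    apply: lee_nneseries => [i _ _|i _]; first exact: es0.
    apply: le_trans (@image_esum_le tau (A i)
      (fine (lmeas R (tau @` A i)) + fine (lmeas R (E i))) 2 M _ _ _ _ _) _ => //.
    - exact: ltW.
    - by rewrite addr_ge0// fine_ge0// lmeas_ge0.
    - exact: le_trans (carl_sub _ (@AL i)) hL.
    - by move=> I /hb.
    - by rewrite mulrAC [M * 2]mulrC EFinM EFinD !fineK ?lmeas_fin.
  have n0 i : (0 <= lmeas R (tau @` A i) + lmeas R (E i))%E.
    by rewrite adde_ge0// lmeas_ge0.
  rewrite nneseriesZl; last by move=> i _; exact: n0.
  rewrite [leRHS]EFinM; apply: lee_wpmul2l; first by rewrite lee_fin mulr_ge0// ltW.
  rewrite nneseriesD; try by move=> i _ _; exact: lmeas_ge0.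
  apply: le_trans (leeD ltA ltE) _; rewrite -EFinD lee_fin; lra.
rewrite -lee_fin (bigID (mem UE)) /= EFinD.
have -> : (2 * M * (3 * M) + M) * dlen R J = 2 * M * (3 * M * dlen R J) + M * dlen R J.
  by ring.
rewrite EFinD addeC; apply: leeD; rewrite -big_filter.
  apply: le_trans sA; apply: sum_le_esum; first exact: filter_uniq.
  move=> K; rewrite mem_filter => /andP[/negP nK /sL/inJ].
  by rewrite hD => -[//|UK]; case: nK; exact: mem_set.
apply: le_trans sE; apply: sum_le_esum; first exact: filter_uniq.
by move=> K; rewrite mem_filter => /andP[/set_mem].
Qed.

End Implications.

(** * Stopping trees *)

Section StoppingTree.
Variables (R : realType) (stop : dyad -> set dyad).
Hypothesis stop_lt : forall K I, stop K I -> dlt I K.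
Hypothesis stop_anti : forall K, antichain (stop K).
Implicit Types (I J K Q : dyad).

Inductive tree : dyad -> Prop :=
| tree_root : tree droot
| tree_stop K I : tree K -> stop K I -> tree I.

(** [I] need not belong to the tree, so this also attaches the intervals between [K] and its
    successors to [K]. *)
Definition parent I K := [/\ tree K, dlt I K & forall K', tree K' -> dlt I K' -> dle K K'].

Lemma dlt_root I : dlt droot I -> False.
Proof. by move/dlt_lev; rewrite ltn0. Qed.

(** Induction on the level of [I], comparing [K] with the predecessor [K1] of [I]. If [K] were
    strictly below [K1], some member of [stop K1] would contain [K] and strictly contain [I],
    against [stop_anti]. *)
Lemma tree_below I K : tree K -> tree I -> dlt I K -> exists2 K', stop K K' & dle I K'.
Proof.
have [n] := ubnP (dlev I); elim: n I K => // n IH I K hn tK tI IK.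
case: tI hn IK => [|K1 {}I tK1 sI] hn IK; first by case: (dlt_root IK).
have IK1 := stop_lt sI.
case: (dlt_nested (dltW IK1) (dltW IK)) => h.
- by exists I; [rewrite -h|exact: dle_refl].
- have [|K' sK' hK'] := IH K1 K _ tK tK1 h; first by have := dlt_lev IK1; lia.
  by exists K' => //; exact: dle_trans (dltW IK1) hK'.
- have [|K' sK' hK'] := IH K K1 _ tK1 tK h; first by have := dlt_lev IK; lia.
  have IK' := dlt_le_trans IK hK'.
  have e := stop_anti sI sK' (dltW IK').
  by move: IK'; rewrite -e => /dltNle; case; exact: dle_refl.
Qed.

Lemma parent_unique I K K' : parent I K -> parent I K' -> K = K'.
Proof. by move=> [t1 l1 h1] [t2 l2 h2]; apply: dle_anti; [exact: h1|exact: h2]. Qed.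

(** The tree contains [droot], so there is a deepest proper ancestor of [I] in the tree. *)
Lemma parent_exists I : I <> droot -> exists K, parent I K.
Proof.
move=> Iroot; have hI : (0 < dlev I)%N.
  rewrite lt0n; apply/eqP => e; apply: Iroot.
  by apply: dle_lev_eq (dle_root I) _; rewrite e.
have hd0 : danc I 0 = droot by have /andP[_ /eqP] := dle_root I.
pose P m := (m < dlev I)%N && `[< tree (danc I m) >].
have exP : exists m, P m.
  by exists 0%N; rewrite /P hI hd0; apply/asboolP; exact: tree_root.
have ubP m : P m -> (m <= dlev I)%N by case/andP => /ltnW.
case: (ex_maxnP exP ubP) => m /andP[hm /asboolP tm] hmax.
exists (danc I m); split => // [|K' tK' hK'].
  rewrite /dlt dle_danc ?(ltnW hm)//=; apply/eqP => e.
  by move: hm; rewrite {1}e dlev_danc ltnn.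
apply: (dle_nested_lev (dle_danc (ltnW hm)) (dltW hK')).
rewrite dlev_danc; apply: hmax; rewrite /P dlt_lev//=; apply/asboolP.
by have /andP[_ /eqP ->] := dltW hK'.
Qed.

(** A tree interval strictly between [I] and [K] would lie in a member of [stop K] strictly
    containing [I]. *)
Lemma stop_parent I K : tree K -> stop K I -> parent I K.
Proof.
move=> tK sI; split => // [|K' tK' hK']; first exact: stop_lt.
case: (dlt_nested (dltW (stop_lt sI)) (dltW hK')) => [->|/dltW//|h].
  exact: dle_refl.
have [K2 sK2 h2] := tree_below tK tK' h.
have IK2 := dlt_le_trans hK' h2.
have e := stop_anti sI sK2 (dltW IK2).
by move: IK2; rewrite -e => /dltNle; case; exact: dle_refl.
Qed.

(* The sets [K \ (stop K)^*], [K] in the tree, are disjoint and each of them has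
   at least half the measure of [K]. *)
Lemma tree_carl : (forall K, (lmeas R (stop K) <= (dlen R K / 2)%:E)%E) ->
  (carl R tree <= 2%:E)%E.
Proof.
move=> hs; apply/carl_leP => J s us sJ.
pose F K := @dint R K `\` dunion (stop K).
have mF K : measurable (F K).
  by apply: measurableD; [exact: measurable_dint|exact: measurable_dunion].
have hF K : ((dlen R K)%:E <= 2%:E * (@lebesgue_measure R) (F K))%E.
  have h1 : ((dlen R K)%:E <= (@lebesgue_measure R) (F K) + lmeas R (stop K))%E.
    rewrite -mu_dint.
    apply: (@le_trans _ _ (@lebesgue_measure R (F K `|` dunion (stop K)))); last first.
      exact: (measureU2 (@lebesgue_measure R) (mF K) (measurable_dunion (stop K))).
    apply: le_measure; rewrite ?inE; first exact: measurable_dint.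
      exact: (measurableU _ _ (mF K) (measurable_dunion (stop K))).
    move=> x xK; have [xs|xs] := pselect (dunion (stop K) x); first by right.
    by left.
  have fF : (@lebesgue_measure R) (F K) \is a fin_num.
    rewrite ge0_fin_numE ?measure_ge0//; apply: (@le_lt_trans _ _ (dlen R K)%:E); last exact: ltry.
    rewrite -mu_dint; apply: le_measure; rewrite ?inE; [exact: mF|exact: measurable_dint|].
    by move=> x [].
  have h2 := le_trans h1 (leeD (le_refl _) (hs K)).
  move: h2; rewrite -(fineK fF) -EFinD -EFinM !lee_fin; lra.
rewrite -lee_fin -sumEFin.
apply: (@le_trans _ _ (\sum_(K <- s) 2%:E * (@lebesgue_measure R) (F K))%E).
  exact: lee_sum.
rewrite -ge0_sume_distrr; last by move=> K _; exact: measure_ge0.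
rewrite EFinM; apply: lee_wpmul2l; first by rewrite lee_fin.
rewrite -mu_dint; apply: sum_mu_le => //.
- move=> K1 K2 /= /sJ[t1 _] /sJ[t2 _] [x [[x1 n1] [x2 n2]]].
  case: (dint_disj x1 x2) => // h.
    have [K' sK' /(@dle_dsub R _ _) hK'] := tree_below t2 t1 h.
    by case: n2; exists K' => //; exact: hK'.
  have [K' sK' /(@dle_dsub R _ _) hK'] := tree_below t1 t2 h.
  by case: n1; exists K' => //; exact: hK'.
- exact: measurable_dint.
- by move=> K /sJ[_ /(@dle_dsub R _ _) h] x [/h].
Qed.

(** Intervals in [Q] whose parent lies in [Q] contribute [c] times the total length of these
    parents, at most [2 * c * dlen R Q]. All others share a single parent, which strictly contains
    [Q], and contribute at most [c * dlen R Q]. *)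
Lemma carl_parent_union (C : dyad -> set dyad) (c : R) : 0 <= c ->
  (carl R tree <= 2%:E)%E ->
  (forall K I, C K I -> parent I K) ->
  (forall K, (carl R (C K) <= c%:E)%E) ->
  (carl R [set I | exists K, C K I] <= (3 * c)%:E)%E.
Proof.
move=> c0 /carl_leP ht hC hc; apply/carl_leP => Q t ut tQ.
have /choice[k hk] : forall I, exists K, (exists K', C K' I) -> C K I.
  by move=> I; have [[K hK]|N] := pselect (exists K, C K I); [exists K|exists I].
have ktC I : I \in t -> C (k I) I by case/tQ => /hk.
have -> : 3 * c * dlen R Q = c * (2 * dlen R Q) + c * dlen R Q by ring.
rewrite (bigID (fun I => dle (k I) Q)) /=; apply: lerD.
  rewrite -big_filter (sum_fiber k).
  set t' := [seq I <- t | _].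
  apply: (@le_trans _ _ (\sum_(K <- undup (map k t')) c * dlen R K)).
    apply: ler_sum => K _; rewrite -big_filter.
    have /carl_leP := hc K; apply; first by rewrite !filter_uniq.
    move=> I; rewrite mem_filter => /andP[/eqP <-].
    rewrite mem_filter => /andP[_ /ktC h]; split => //.
    by case: (hC _ _ h) => _ /dltW.
  rewrite -mulr_sumr; apply: ler_wpM2l => //; apply: ht; first exact: undup_uniq.
  move=> K; rewrite mem_undup => /mapP[I]; rewrite mem_filter => /andP[h1 /ktC h2] ->.
  by split => //; case: (hC _ _ h2).
rewrite -big_filter; set t' := [seq I <- t | _].
have ht' I : I \in t' -> [/\ C (k I) I, dle I Q & dlt Q (k I)].
  rewrite mem_filter => /andP[h1 It]; have h2 := ktC _ It; have [_ h3] := tQ _ It.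
  split => //; have [_ h4 _] := hC _ _ h2.
  case: (dlt_nested h3 (dltW h4)) => // [e|h]; first by rewrite e dle_refl in h1.
  by rewrite dltW in h1.
case E : t' => [|I1 t1]; first by rewrite big_nil mulr_ge0 ?dlen_ge0.
rewrite -E; have I1t : I1 \in t' by rewrite E mem_head.
have [a1 a2 a3] := ht' _ I1t.
have /carl_leP := hc (k I1); apply; first by rewrite filter_uniq.
move=> I /ht'[b1 b2 b3]; split => //.
(* Each of the two parents strictly contains [Q], hence both intervals, so minimality applies both
   ways. *)
suff -> : k I1 = k I by [].
have [p1 p2 p3] := hC _ _ a1; have [q1 q2 q3] := hC _ _ b1.
apply: dle_anti; first by apply: p3 => //; exact: dle_lt_trans a2 b3.
by apply: q3 => //; exact: dle_lt_trans b2 a3.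
Qed.

End StoppingTree.

(** * From Carleson bounds to the weak-Property P *)

Section WeakP.
Variable R : realType.
Implicit Types (I J K Q : dyad) (L : set dyad) (s t : seq dyad).

Lemma lmeasU L L' : (lmeas R (L `|` L') <= lmeas R L + lmeas R L')%E.
Proof.
have -> : lmeas R (L `|` L') = @lebesgue_measure R (dunion L `|` dunion L').
  by rewrite /lmeas /dunion bigcup_setU.
exact: (measureU2 (@lebesgue_measure R) (measurable_dunion L) (measurable_dunion L')).
Qed.

Section Rearrangement.
Variables (tau : dyad -> dyad) (M : R) (B : set dyad) (J0 : dyad).
Hypothesis tau_inj : injective tau.
Hypothesis M_ge1 : 1 <= M.
Hypothesis tau_carl : forall L, (carl R (tau @` L) <= M%:E * carl R L)%E.
Hypothesis tauB : forall I, B I -> dle (tau I) J0.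

Let M0 : 0 < M. Proof. exact: lt_le_trans ltr01 M_ge1. Qed.

(** An antichain is 1-Carleson, so its image is [M]-Carleson and the image lengths sum to at most
    [M] times the measure they cover. *)
Lemma lmeas_image (P : set dyad) (th : R) : antichain P -> 0 < th ->
  (forall I, P I -> th * dlen R I <= dlen R (tau I)) ->
  th * fine (lmeas R P) <= M * fine (lmeas R (tau @` P)).
Proof.
move=> aP th0 hP; rewrite -ler_pdivlMl// -lee_fin fineK ?lmeas_fin//.
apply: le_trans (lmeas_le_esum R P) _.
apply/esum_le_seqP => [I _|s us sP]; first exact: dlen_ge0.
rewrite lee_fin ler_pdivlMl// mulr_sumr.
apply: (@le_trans _ _ (\sum_(I <- s) dlen R (tau I))).
  by rewrite big_seq [leRHS]big_seq; apply: ler_sum => I /sP /hP.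
rewrite -(big_map tau xpredT (dlen R)) -lee_fin EFinM fineK ?lmeas_fin//.
apply: carl_lmeas.
- apply: le_trans (tau_carl P) _; rewrite -[leRHS]mule1.
  by apply: lee_wpmul2l (carl_antichain R aP); rewrite lee_fin ltW.
- by rewrite map_inj_uniq.
- by move=> K /mapP[I /sP PI ->]; exists I.
Qed.

Let high K th : set dyad := [set I | [/\ B I, dlt I K & th * dlen R I <= dlen R (tau I)]].

Let high_le K th th' : th <= th' -> high K th' `<=` high K th.
Proof.
move=> h I [h1 h2 h3]; split => //; apply: le_trans h3.
by rewrite ler_wpM2r ?dlen_ge0.
Qed.

(** The candidates [T / 2 ^+ n] are lowered until the covered part exceeds half of [K]; the last one
    before that is taken, or 0 if this never happens. *)
Lemma threshold K : exists th : R, [/\ 0 <= th,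
  (lmeas R (high K th) <= (dlen R K / 2)%:E)%E &
  forall I, B I -> dlt I K -> dlen R (tau I) < th * dlen R I ->
    dlen R K / 2 <= fine (lmeas R (high K (th / 2)))].
Proof.
(* All images lie in [J0], so by [lmeas_image] the intervals with ratio at least [T] cover at most
   [M * dlen R J0 / T], which is half of [K]. *)
pose T : R := 2 * M * dlen R J0 / dlen R K.
have T0 : 0 < T by rewrite divr_gt0 ?mulr_gt0 ?dlen_gt0.
pose th n := T / 2 ^+ n.
have th0 n : 0 < th n by rewrite divr_gt0 ?exprn_gt0.
have hT : (lmeas R (high K (th 0%N)) <= (dlen R K / 2)%:E)%E.
  rewrite /th expr0 divr1 -(lmeas_dmax R) -(fineK (lmeas_fin _ _)) lee_fin.
  rewrite -(ler_pM2l T0); apply: le_trans (lmeas_image _ _ _) _ => //.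
  - exact: antichain_dmax.
  - by move=> I /dmax_sub[].
  have -> : T * (dlen R K / 2) = M * dlen R J0.
    by rewrite /T; field; rewrite gt_eqF ?dlen_gt0.
  rewrite ler_pM2l// -lee_fin fineK ?lmeas_fin//; apply: lmeas_le.
  by move=> _ [I /dmax_sub[BI _ _] <-]; exact: tauB.
pose P n := `[< ~ (lmeas R (high K (th n)) <= (dlen R K / 2)%:E)%E >].
have [exP|N] := pselect (exists n, P n).
  (* The first bad index is positive by the choice of [T]; its predecessor [m] is good, and half of
     [th m] is bad. *)
  case: (ex_minnP exP) => -[|m] /asboolP hm hmin; first by case: hm.
  have thm : th m / 2 = th m.+1 by rewrite /th exprSr invfM mulrA.
  exists (th m); split; first exact: ltW.
    by apply: contrapT => h; have := hmin m (asboolT h); rewrite ltnn.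
  move=> I _ _ _; rewrite thm; move/negP: hm; rewrite -ltNge.
  by rewrite -(fineK (lmeas_fin _ _)) lte_fin => /ltW.
(* With threshold 0 the last clause is vacuous, since lengths are not negative. *)
exists 0; split => //; last first.
  by move=> I _ _; rewrite mul0r ltNge dlen_ge0.
rewrite -(lmeas_dmax R); apply: le_trans (lmeas_le_esum R _) _.
apply/esum_le_seqP => [I _|s us sH]; first exact: dlen_ge0.
(* The finitely many ratios in [s] are positive, so [th m] is below all of them for this [m]. *)
pose bd I := Num.bound (T * dlen R I / dlen R (tau I)).
pose m := (\max_(I <- s) bd I)%N.
have hs I : I \in s -> high K (th m) I.
  move=> Is; have /dmax_sub[h1 h2 _] := sH _ Is; split => //.
  rewrite /th mulrAC ler_pdivrMr ?exprn_gt0// [leRHS]mulrC -ler_pdivrMr ?dlen_gt0//.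
  apply: le_trans (ltW (archi_boundP _)) _.
    exact: divr_ge0 (mulr_ge0 (ltW T0) (dlen_ge0 _ _)) (dlen_ge0 _ _).
  apply: (@le_trans _ _ m%:R).
    by rewrite ler_nat; rewrite -/(bd I) /m; exact: leq_bigmax_seq.
  by rewrite -natrX ler_nat ltnW// ltn_expl.
apply: (@le_trans _ _ (lmeas R (high K (th m)))); last first.
  by apply: contrapT => h; apply: N; exists m; exact/asboolP.
apply: (@le_trans _ _ (lmeas R [set` s])).
  apply: antichain_sum => // I I' /= Is I's.
  by apply: (@antichain_dmax R (high K 0)); exact: sH.
by apply: lmeas_sub => x [I /= /hs hI xI]; exists I.
Qed.

Let theta := projT1 (choice threshold).
Let theta_ge0 K : 0 <= theta K.
Proof. by case: (projT2 (choice threshold) K). Qed.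
Let theta_le K : (lmeas R (high K (theta K)) <= (dlen R K / 2)%:E)%E.
Proof. by case: (projT2 (choice threshold) K). Qed.
Let theta_half K I : B I -> dlt I K -> dlen R (tau I) < theta K * dlen R I ->
  dlen R K / 2 <= fine (lmeas R (high K (theta K / 2))).
Proof. by case: (projT2 (choice threshold) K) => _ _; exact. Qed.

Let stop K := dmax R (high K (theta K)).
Let stop_lt K I : stop K I -> dlt I K. Proof. by case/dmax_sub. Qed.
Let stop_anti K : antichain (stop K). Proof. exact: antichain_dmax. Qed.
Let stop_le K : (lmeas R (stop K) <= (dlen R K / 2)%:E)%E.
Proof. by rewrite lmeas_dmax; exact: theta_le. Qed.

(** [mid K] serves as the collection $L_i$ of [K], and the image of [out K] as $E_i$. *)
Let mid K : set dyad := [set I | [/\ B I, ~ tree stop I & parent stop I K]].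
(* [droot] is the only interval of the tree that succeeds no other one. *)
Let out K : set dyad :=
  [set I | [/\ B I, tree stop K & stop K I \/ (I = droot /\ K = droot)]].

(** If a tree interval lies between [I] and [K], then [I] is contained in a member of [stop K]. That
    member also has ratio at least [theta K / 2], so by maximality it is [I]. *)
Let half_max K I : dmax R (high K (theta K / 2)) I -> tree stop K -> mid K I \/ out K I.
Proof.
move=> [[BI IK hI] Imax] tK.
have below K' : tree stop K' -> dle I K' -> dlt K' K -> stop K I.
  move=> tK' IK' K'K; have [K2 sK2 h2] := tree_below stop_lt stop_anti tK tK' K'K.
  have <- // : K2 = I.
  apply: Imax; last by apply/dsubP; exact: dle_trans IK' h2.
  apply: (high_le _ (dmax_sub sK2)).
  by have := theta_ge0 K; lra.
have [tI|tI] := pselect (tree stop I).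
  by right; split => //; left; exact: (below I tI (dle_refl I)).
have [sI|sI] := pselect (stop K I); first by case: tI; exact: tree_stop tK sI.
left; split => //; split => // K' tK' hK'.
case: (dlt_nested (dltW IK) (dltW hK')) => [->|/dltW//|h].
  exact: dle_refl.
by case: sI; exact: (below K' tK' (dltW hK') h).
Qed.

(** The ratio of [I] is below [theta K], so intervals of ratio at least [theta K / 2] cover half of
    [K]. The two halves and [lmeas_image] give the factor [4 * M]. *)
Let mid_ratio K I : mid K I -> dlen R (tau I) / dlen R I <=
  4 * M * (fine (lmeas R (tau @` mid K)) + fine (lmeas R (tau @` out K))) /
    fine (lmeas R (mid K)).
Proof.
move=> hI; have [BI tI pI] := hI; have [tK IK Kmin] := pI.
have lI : dlen R (tau I) < theta K * dlen R I.
  rewrite ltNge; apply/negP => h.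
  (* Otherwise [I], not being in the tree, lies strictly inside a successor of [K], against the
     minimality of the parent [K]. *)
  have [K2 sK2 h2] : exists2 K2, stop K K2 & dle I K2 by apply: dmaxP.
  have tK2 := tree_stop tK sK2.
  case: (dle_eqVlt h2) => [e|h3]; first by rewrite e in tI.
  exact: dltNle (stop_lt sK2) (Kmin _ tK2 h3).
have th0 : 0 < theta K.
  by rewrite -(pmulr_lgt0 _ (dlen_gt0 R I)) (le_lt_trans (dlen_ge0 R (tau I))).
have h1 := theta_half BI IK lI.
pose P := dmax R (high K (theta K / 2)).
have h2 : theta K / 2 * fine (lmeas R P) <= M * fine (lmeas R (tau @` P)).
  apply: lmeas_image; [exact: antichain_dmax|by rewrite divr_gt0|].
  by move=> Q /dmax_sub[].
have h3 : fine (lmeas R (tau @` P)) <=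
    fine (lmeas R (tau @` mid K)) + fine (lmeas R (tau @` out K)).
  rewrite -lee_fin EFinD !fineK ?lmeas_fin//.
  apply: le_trans _ (lmeasU _ _); apply: lmeas_sub => x [_ [Q hQ <-] xQ].
  exists (tau Q) => //.
  by case: (half_max hQ tK) => h; [left|right]; exists Q.
rewrite /P lmeas_dmax in h2; move: h1 h2 h3.
set p := fine (lmeas R (high _ _)); set q := fine (lmeas R (tau @` _)).
set b := fine (lmeas R (tau @` mid K)) + _ => h1 h2 h3.
have a0 : 0 < fine (lmeas R (mid K)) by exact: (lmeas_gt0 R hI).
have aK : fine (lmeas R (mid K)) <= dlen R K.
  rewrite -lee_fin fineK ?lmeas_fin//; apply: lmeas_le => Q [_ _ [_ /dltW//]].
rewrite ler_pdivlMr//; apply: (@le_trans _ _ (theta K * dlen R K)).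
  apply: ler_pM => //; first by rewrite divr_ge0 ?dlen_ge0.
    exact: ltW.
  by rewrite ler_pdivrMr ?dlen_gt0// ltW.
have h4 : theta K / 2 * (dlen R K / 2) <= theta K / 2 * p.
  by rewrite ler_pM2l// divr_gt0.
have h5 : M * q <= M * b by rewrite ler_pM2l.
lra.
Qed.

Let tree_carl2 : (carl R (tree stop) <= 2%:E)%E.
Proof. exact: (tree_carl stop_lt stop_anti stop_le). Qed.

Let top K : set dyad := tau @^-1` (dmax R (tau @` mid K)).

Let top_sub K : top K `<=` mid K.
Proof. by move=> I /dmax_sub[I' hI' /tau_inj <-]. Qed.

Let out_tree K I : out K I -> tree stop I.
Proof.
by move=> [_ tK [/(tree_stop tK)//|[-> _]]]; exact: tree_root.
Qed.

Let out_unique K K' I : out K I -> out K' I -> K = K'.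
Proof.
move=> [_ tK h] [_ tK' h'].
case: h => [sI|[eI eK]]; case: h' => [sI'|[eI' eK']].
- exact: (parent_unique (stop_parent stop_lt stop_anti tK sI)
                        (stop_parent stop_lt stop_anti tK' sI')).
- by move/stop_lt: sI; rewrite eI' => /dlt_root.
- by move/stop_lt: sI'; rewrite eI => /dlt_root.
- by rewrite eK eK'.
Qed.

Let cover I : B I -> exists K, mid K I \/ out K I.
Proof.
move=> BI; have [tI|tI] := pselect (tree stop I); last first.
  have [K hK] : exists K, parent stop I K.
    by apply: parent_exists => e; apply: tI; rewrite e; exact: tree_root.
  by exists K; left.
case: tI BI => [|K {}I tK sI] BI.
  by exists droot; right; split => //; [exact: tree_root|right].
by exists K; right; split => //; left.
Qed.

Lemma weak_P_decomposition : exists (L E : nat -> set dyad),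
    tau @` B = \bigcup_(i in [set: nat]) (tau @` L i) `|`
               \bigcup_(i in [set: nat]) E i /\
    (forall i j, i <> j -> tau @` L i `&` tau @` L j = set0) /\
    (forall i j, i <> j -> E i `&` E j = set0) /\
    (forall i j, tau @` L i `&` E j = set0) /\
    (carl R (\bigcup_(i in [set: nat]) E i) <= (4 * M)%:E)%E /\
    (forall i I, L i I ->
      dlen R (tau I) / dlen R I <=
      4 * M * (fine (lmeas R (tau @` L i)) + fine (lmeas R (E i))) / fine (lmeas R (L i))) /\
    (\sum_(0 <= i <oo) lmeas R (tau @` L i) <=
      (4 * M * dlen R J0)%:E *
      ereal_sup (range (fun i => carl R (tau @^-1` (dmax R (tau @` L i))))))%E.
Proof.
(* Families indexed by intervals are re-indexed by codes; numbers that are not codes, and intervals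
   outside the tree, give empty collections. *)
pose at_ (F : dyad -> set dyad) (i : nat) : set dyad :=
  [set I | exists2 K, pickle K = i & F K I].
have pinj : injective (pickle : dyad -> nat) := pcan_inj pickleK.
have at_pickle F K : at_ F (pickle K) = F K.
  by apply/seteqP; split => [I [K' /pinj ->]|I h] //; exists K.
have at_out F i : ~ (exists K, pickle K = i) -> at_ F i = set0.
  by move=> h; rewrite -subset0 => I [K hK _]; apply: h; exists K.
have disj (F : dyad -> set dyad) : (forall K K' I, F K I -> F K' I -> K = K') ->
    forall i j, i <> j -> tau @` at_ F i `&` tau @` at_ F j = set0.
  move=> hF i j ij; rewrite -subset0 => _ [[I [K hK FI] <-] [I' [K' hK' FI'] /tau_inj e]].
  by apply: ij; rewrite -hK -hK' (hF _ _ _ FI (_ : F K' I)) -?e.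
have mid_unique K K' I : mid K I -> mid K' I -> K = K'.
  by move=> [_ _ h] [_ _ h']; exact: parent_unique h h'.
exists (at_ mid), (fun i => tau @` at_ out i); split; [|split; [|split; [|split; [|split; [|split]]]]].
- apply/seteqP; split => [_ [I /cover[K [h|h]] <-]|_ [] [i _ [I [K _ h] <-]]].
  + by left; exists (pickle K) => //; exists I => //; exists K.
  + by right; exists (pickle K) => //; exists I => //; exists K.
  + by exists I => //; case: h.
  + by exists I => //; case: h.
- exact: disj mid_unique.
- exact: disj out_unique.
- move=> i j; rewrite -subset0 => _ [[I [K hK [_ nI _]] <-] [I' [K' hK' h] /tau_inj e]].
  by apply: nI; rewrite -e; exact: out_tree h.
- apply: (@le_trans _ _ (carl R (tau @` tree stop))).
    apply: carl_sub => _ [i _ [I [K _ h] <-]].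
    by exists I => //; exact: out_tree h.
  apply: le_trans (tau_carl _) _; apply: le_trans (lee_wpmul2l _ tree_carl2) _.
    by rewrite lee_fin ltW.
  by rewrite -EFinM lee_fin; move: M0; lra.
- by move=> i I [K <- hI]; rewrite !at_pickle; exact: mid_ratio.
set sg := ereal_sup _.
have sg0 : (0 <= sg)%E.
  apply: le_trans (ereal_sup_ubound _); last by exists 0%N.
  exact: carl_ge0.
have MJ : 0 < 4 * M * dlen R J0 by rewrite !mulr_gt0 ?dlen_gt0.
case: (boolP (sg \is a fin_num)) => [sf|]; last first.
  rewrite ge0_fin_numE// -leNgt leye_eq => /eqP ->.
  by rewrite mulry gtr0_sg// mul1e leey.
have := fineK sf; move: (fine sg) => c cE.
have c0 : 0 <= c by rewrite -lee_fin cE.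
have topc K : (carl R (top K) <= c%:E)%E.
  rewrite cE; apply: ereal_sup_ubound; exists (pickle K) => //.
  by rewrite at_pickle.
have hu : (carl R [set I | exists K, top K I] <= (3 * c)%:E)%E.
  apply: (carl_parent_union c0 tree_carl2) topc.
  by move=> K I /top_sub[].
(* The maximal images come from the merged tops, which are [3 * c]-Carleson, so together they are
   [3 * M * c]-Carleson inside [J0]. Their total length dominates the sum in (c). *)
pose D i := dmax R (tau @` at_ mid i).
have Dtop : \bigcup_i D i `<=` tau @` [set I | exists K, top K I].
  move=> K [i _ hK]; have [I [Q hQ hI] e] := dmax_sub hK.
  exists I => //; exists Q; rewrite /top /preimage /= e.
  by move: hK; rewrite /D -hQ at_pickle.
apply: (@le_trans _ _ (\esum_(K in \bigcup_i D i) (dlen R K)%:E)%E).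
  rewrite esum_bigcupT; first last.
  - by move=> K; rewrite lee_fin dlen_ge0.
  - move=> i j _ _ [K [/dmax_sub h1 /dmax_sub h2]]; apply: contrapT => ij.
    by have := disj _ mid_unique _ _ ij; rewrite -subset0 => /(_ K); apply.
  rewrite -nneseries_esumT; last first.
    by move=> i; apply: esum_ge0 => K _; rewrite lee_fin dlen_ge0.
  apply: lee_nneseries => [i _ _|i _]; first exact: lmeas_ge0.
  by rewrite -(lmeas_dmax R); exact: lmeas_le_esum.
have hD : (carl R (\bigcup_i D i) <= (M * (3 * c))%:E)%E.
  apply: le_trans (carl_sub R Dtop) _; apply: le_trans (tau_carl _) _.
  by rewrite EFinM; apply: lee_wpmul2l hu; rewrite lee_fin ltW.
apply: le_trans (esum_le_carl hD (J := J0) _) _.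
  by move=> K [i _ /dmax_sub[I [Q _ [BI _ _]] <-]]; exact: tauB.
rewrite -cE -EFinM lee_fin -subr_ge0.
have -> : 4 * M * dlen R J0 * c - M * (3 * c) * dlen R J0 = M * (dlen R J0 * c) by ring.
by rewrite !mulr_ge0 ?dlen_ge0// ltW.
Qed.

End Rearrangement.

End WeakP.

(** * Assembling the equivalences *)

Lemma carl_bounded_weak_P (R : realType) (tau : dyad -> dyad) (M : R) : injective tau ->
  1 <= M -> (forall L, (carl R (tau @` L) <= M%:E * carl R L)%E) ->
  weak_property_P R tau.
Proof.
move=> ti M1 hM; exists (4 * M); split; first by rewrite mulr_gt0// (lt_le_trans ltr01 M1).
move=> B J; pose B' := [set I | B I /\ dle (tau I) J].
have -> : dcapJ R (tau @` B) J = tau @` B'.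
  apply/seteqP; split => [K [[I BI <-] /dsubP h]|_ [I [BI h] <-]].
    by exists I.
  by split; [exists I|apply/dsubP].
by apply: (weak_P_decomposition ti M1 hM) => I [].
Qed.

Lemma carl_bounded_sparse (R : realType) (tau : dyad -> dyad) (M : R) : 1 <= M ->
  (forall L, (carl R (tau @` L) <= M%:E * carl R L)%E) -> sparse_bounded tau (M * 2).
Proof.
move=> M1 hM L hL; apply: le_trans (hM L) _; rewrite EFinM.
by apply: lee_wpmul2l hL; rewrite lee_fin (le_trans ler01 M1).
Qed.

Unset Implicit Arguments.

Theorem theorem2 (R : realType) (tau : dyad -> dyad) :
  rearrangement tau ->
  (T_bounded_BMO R tau <->
   (exists M : R, 1 <= M /\
      forall L : set dyad, (carl R (tau @` L) <= M%:E * carl R L)%E)) /\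
  ((exists M : R, 1 <= M /\
      forall L : set dyad, (carl R (tau @` L) <= M%:E * carl R L)%E) <->
   weak_property_P R tau).
Proof.
move=> ti; split; split.
- exact: BMO_bounded_carl.
- move=> [M [M1 hM]]; exact: (sparse_bounded_BMO ti (carl_bounded_sparse M1 hM)).
- by move=> [M [M1 hM]]; exact: carl_bounded_weak_P M1 hM.
(* The step from (iii) back to (ii) passes through the boundedness of the operator, which extends
   the sparse bound to all collections. *)
- move=> /(weak_P_sparse ti)[C hC].
  exact: (BMO_bounded_carl ti (sparse_bounded_BMO ti hC)).
Qed.
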